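(* Let $K$ be a field of characteristic $2$, let $n > 0$ be an integer with consecutive-ones binary expansion $n = \sum_{1 \leq i \leq r} (-1)^{i+1} 2^{\beta_i}$, $\beta_1 > \cdots > \beta_r \geq 0$, and let $q \geq n$ be a power of $2$. Let $e$ be a generator of $\mathfrak{w}_q$, acting on $W_n \otimes W_n$, and let $n_1, \ldots, n_{r+1}$ and $w_s \in W_n \otimes W_n$ ($1 \leq s \leq n$) be as defined in the context. For $1 \leq k \leq r$, define $$B_k := \{ e^j w_s : 1 \leq s \leq n,\ n_k > n-s \geq n_{k+1} \text{ and } 0 \leq j \leq 2^{\beta_k}-1 \}.$$ Then $B := \bigcup_{1 \leq k \leq r} B_k$ is a Jordan basis for the action of $e$ on $W_n \otimes W_n$.
   Context: The consecutive-ones binary expansion of an integer $n > 0$ is the alternating sum $n = \sum_{1 \leq i \leq r} (-1)^{i+1} 2^{\beta_i}$ such that $\beta_1 > \cdots > \beta_r \geq 0$ and $r$ is minimal. Define $n_k := \sum_{k \leq i \leq r} (-1)^{i+k} 2^{\beta_i}$ for $1 \leq k \leq r$, and $n_{r+1} := 0$; then $n = n_1 > n_2 > \cdots > n_r > n_{r+1} = 0$. $\mathfrak{w}_q$ is the abelian $2$-Lie algebra (restricted Lie algebra) over $K$ generated by a nilpotent element $e$ with $e^{[q]}=0$, and $W_n$ is the $n$-dimensional restricted $\mathfrak{w}_q$-module on which $e$ acts as a single nilpotent Jordan block. Fix a basis $v_1, \ldots, v_n$ of $W_n$ with $ev_1 = 0$ and $ev_i = v_{i-1}$ for $1 < i \leq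 n$; put $v_j = 0$ for $j \leq 0$ and for $j > n$. The action on $W_n \otimes W_n$ is $e \cdot (v \otimes w) = ev \otimes w + v \otimes ew$. For $1 \leq s \leq n$ define $z_s := \sum_{1 \leq i \leq s} v_i \otimes v_{s+1-i}$. For $1 \leq s \leq n$, let $k$ be the unique index with $1 \leq k \leq r$ and $n_k > n-s \geq n_{k+1}$, and let $\beta = \beta_k$. If $\beta = 0$, set $w_s := z_s$. If $\beta > 0$, set $$w_s := \sum_{-j_0 \leq j \leq j_0} v_{\lfloor s/2 \rfloor + 2^{\beta-1} + j2^{\beta}} \otimes v_{\lceil s/2 \rceil + 2^{\beta-1} - j2^{\beta}},$$ where $j_0 \geq 0$ is an integer (which exists, and is fixed for each $s$) such that $s \leq \lfloor s/2 \rfloor + 2^{\beta-1} + j_02^{\beta} \leq n$ and $s \leq \lceil s/2 \rceil + 2^{\beta-1} + j_02^{\beta} \leq n$. For a nilpotent linear map $e: V \to V$, a Jordan chain is a set of non-zero vectors $\{w, ew, \ldots, e^k w\}$ with $k \geq 0$ and $e^{k+1}w = 0$; a Jordan basis for the action of $e$ on $V$ is a basis of $V$ which is a disjoint union of Jordan chains. *)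

(* Defs.v *)
From HB Require Import structures.
From mathcomp Require Import all_boot all_order all_algebra.
From mathcomp Require Import classical_sets.

Set Implicit Arguments.
Unset Strict Implicit.
Unset Printing Implicit Defensive.

Import Order.TTheory GRing.Theory Num.Theory.
Local Open Scope ring_scope.

(* Exponent sequences are seq nat; the 1-based beta_i is [nth 0 b i.-1]. *)
Section ConsecutiveOnes.

Definition beta (b : seq nat) (i : nat) : nat := nth 0%N b i.-1.

Definition alternating_expansion (n : nat) (b : seq nat) : Prop :=
  sorted gtn b /\
  n%:Z = \sum_(1 <= i < (size b).+1) (-1) ^+ i.+1 * 2%:Z ^+ beta b i.

Definition consecutive_ones_expansion (n : nat) (b : seq nat) : Prop :=
  alternating_expansion n b /\
  forall c : seq nat, alternating_expansion n c -> (size b <= size c)%N.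

(* The sum is empty, hence 0, for k = size b + 1. *)
Definition tail_sum (b : seq nat) (k : nat) : int :=
  \sum_(k <= i < (size b).+1) (-1) ^+ (i + k) * 2%:Z ^+ beta b i.

(* n_k > n - s >= n_(k+1) *)
Definition in_block (n : nat) (b : seq nat) (k s : nat) : bool :=
  tail_sum b k.+1 <= n%:Z - s%:Z < tail_sum b k.

(* The k in 1..r with [in_block n b k s]; it exists and is unique when
   1 <= s <= n and b is the consecutive-ones expansion of n. *)
Definition block_index (n : nat) (b : seq nat) (s : nat) : nat :=
  (find (fun i => in_block n b i.+1 s) (iota 0 (size b))).+1.

End ConsecutiveOnes.

(* The abelian 2-Lie algebra w_q over K, for q = 2 ^ m, is 'rV[K]_m with zero
   bracket: the i-th unit vector (i < m) is the (2 ^ i)-fold 2-power of the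
   standard generator, and the (2 ^ m)-fold one vanishes. *)
Section RestrictedLie.
Variables (K : fieldType) (m : nat).

(* The 2-map: the 2-semilinear map sending the i-th unit vector to the next. *)
Definition two_map (x : 'rV[K]_m) : 'rV[K]_m :=
  \row_(i < m) \sum_(j < m | j.+1 == i :> nat) x 0 j ^+ 2.

Definition restricted_generator (e : 'rV[K]_m) : Prop :=
  forall U : {vspace 'rV[K]_m},
    e \in U -> (forall x, x \in U -> two_map x \in U) -> U = fullv.

(* Brackets go to commutators, and the bracket is zero; the 2-map goes to
   squaring of endomorphisms. *)
Definition restricted_module (n : nat) (rho : {linear 'rV[K]_m -> 'M[K]_n}) :
    Prop :=
  (forall x y, rho x *m rho y - rho y *m rho x = 0) /\
  (forall x, rho (two_map x) = rho x *m rho x).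

End RestrictedLie.

(* W = 'cV[K]_n, with endomorphisms acting by left multiplication; W (x) W is
   'M[K]_n, with pure tensors v *m w^T. *)
Section TensorSquare.
Variables (K : fieldType) (n : nat).

Definition tens (v w : 'cV[K]_n) : 'M[K]_n := v *m w^T.

Definition tens_act (A : 'M[K]_n) : {linear 'M[K]_n -> 'M[K]_n} :=
  mulmx A \+ mulmxr A^T.

Lemma tens_actE (A : 'M[K]_n) (v w : 'cV[K]_n) :
  tens_act A (tens v w) = tens (A *m v) w + tens v (A *m w).
Proof. by rewrite /tens_act /tens /= trmx_mul !mulmxA. Qed.

(* A acts as a single nilpotent Jordan block in the basis v_1, ..., v_n; the
   family v is extended by 0 to all integer indices. *)
Definition single_block_basis (A : 'M[K]_n) (v : int -> 'cV[K]_n) : Prop :=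
  [/\ basis_of {: 'cV[K]_n} [seq v i%:Z | i <- iota 1 n],
      forall i : int, (i <= 0) || (n%:Z < i) -> v i = 0
    & forall i : int, 1 <= i <= n%:Z -> A *m v i = v (i - 1)].

Variable v : int -> 'cV[K]_n.

Definition z_vec (s : nat) : 'M[K]_n :=
  \sum_(1 <= i < s.+1) tens (v i%:Z) (v (s%:Z + 1 - i%:Z)).

(* The conditions on the integer j0 chosen for s when the relevant exponent is
   bt > 0. *)
Definition admissible_j0 (bt s j0 : nat) : Prop :=
  (s <= s./2 + 2 ^ bt.-1 + j0 * 2 ^ bt <= n)%N /\
  (s <= uphalf s + 2 ^ bt.-1 + j0 * 2 ^ bt <= n)%N.

(* The summation index is shifted: j = t - j0 runs over -j0, ..., j0. *)
Definition w_vec (b : seq nat) (j0 : nat -> nat) (s : nat) : 'M[K]_n :=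
  let bt := beta b (block_index n b s) in
  if bt == 0%N then z_vec s else
  \sum_(0 <= t < (2 * j0 s).+1)
    let j := t%:Z - (j0 s)%:Z in
    tens (v (s./2%:Z + 2%:Z ^+ bt.-1 + j * 2%:Z ^+ bt))
         (v ((uphalf s)%:Z + 2%:Z ^+ bt.-1 - j * 2%:Z ^+ bt)).

End TensorSquare.

Section JordanBasis.
Variables (K : fieldType) (V : vectType K) (f : {linear V -> V}).
Local Open Scope classical_set_scope.

Definition jordan_chain (C : set V) : Prop :=
  exists (w : V) (k : nat),
    [/\ forall j, (j <= k)%N -> iter j f w != 0,
        iter k.+1 f w = 0
      & C = [set iter j f w | j in [set j | (j <= k)%N]]].

Definition set_basis (B : set V) : Prop :=
  exists X : seq V, basis_of {: V} X /\ B = [set` X].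

Definition jordan_basis (B : set V) : Prop :=
  set_basis B /\
  exists F : set (set V),
    [/\ forall C, F C -> jordan_chain C,
        trivIset F id
      & B = \bigcup_(C in F) C].

End JordanBasis.

Section Blocks.
Variables (K : fieldType) (n : nat).
Local Open Scope classical_set_scope.

Definition B_block (A : 'M[K]_n) (v : int -> 'cV[K]_n) (b : seq nat)
    (j0 : nat -> nat) (k : nat) : set 'M[K]_n :=
  [set x | exists s j : nat,
     [/\ (1 <= s <= n)%N, in_block n b k s, (j <= 2 ^ beta b k - 1)%N
       & x = iter j (tens_act A) (w_vec v b j0 s)]].

Definition B_union (A : 'M[K]_n) (v : int -> 'cV[K]_n) (b : seq nat)
    (j0 : nat -> nat) : set 'M[K]_n :=
  \bigcup_(k in [set k | (1 <= k <= size b)%N]) B_block A v b j0 k.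

End Blocks.

(* Main.v *)
(** With [a = e (x) 1] and [b = 1 (x) e], characteristic 2 gives
    [(a + b) ^ (2 ^ k - 1) = \sum_(i < 2 ^ k) a ^ i b ^ (2 ^ k - 1 - i)].
    Applied to the terms of [w_s], whose first indices are spaced by
    [2 ^ beta], this joins up into one sum over a whole antidiagonal, so that
    [e ^ (2 ^ beta - 1) w_s = z_s].  Since the [z_s] are linearly independent
    and killed by [e], the chains are independent.  As
    [n_k + n_(k+1) = 2 ^ beta_k], their total length is the telescoping sum
    of the [(n_k - n_(k+1)) (n_k + n_(k+1))], that is, [n ^ 2]. *)

Require Import Defs.
From HB Require Import structures.
From mathcomp Require Import all_boot all_order all_algebra.
From mathcomp Require Import classical_sets.
From mathcomp Require Import zify.
Import Order.TTheory GRing.Theory Num.Theory.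
Local Open Scope ring_scope.

Set Implicit Arguments.
Unset Strict Implicit.
Unset Printing Implicit Defensive.

(** * Jordan chains with independent ends *)

Section FreeFamilies.
Variables (K : fieldType) (V : vectType K).

Lemma free_codomP (I : finType) (g : I -> V) :
  reflect (forall c : I -> K, \sum_x c x *: g x = 0 -> forall x, c x = 0)
          (free (codom g)).
Proof.
apply: (iffP (freeP (X := codom_tuple g))) => [fg c c0 x | fg c c0 i].
  rewrite -(enum_rankK x); apply: (fg (c \o enum_val)).
  rewrite -[RHS]c0 (reindex (@enum_val I predT)) /=; last first.
    by exists enum_rank => y _; rewrite ?enum_valK ?enum_rankK.
  by apply: eq_bigr => j _; rewrite nth_codom.
rewrite -(enum_valK i); apply: (fg (c \o enum_rank)).
rewrite -[RHS]c0 (reindex (@enum_rank I)) /=; last first.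
  by exists enum_val => y _; rewrite ?enum_valK ?enum_rankK.
by apply: eq_bigr => j _; rewrite nth_codom enum_rankK.
Qed.

Lemma iter_linear0 (f : {linear V -> V}) (m : nat) : iter m f 0 = 0.
Proof. by elim: m => //= m ->; rewrite linear0. Qed.

Lemma iter_linearD (f : {linear V -> V}) (m : nat) :
  {morph iter m f : x y / x + y}.
Proof. by move=> x y; elim: m => //= m ->; rewrite linearD. Qed.

Lemma iter_linearZ (f : {linear V -> V}) (m : nat) (a : K) :
  {morph iter m f : x / a *: x}.
Proof. by move=> x; elim: m => //= m ->; rewrite linearZ. Qed.

Lemma iter_linear_sum (f : {linear V -> V}) (m : nat) (I : Type) (r : seq I)
    (P : pred I) (g : I -> V) :
  iter m f (\sum_(x <- r | P x) g x) = \sum_(x <- r | P x) iter m f (g x).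
Proof. exact: (big_morph _ (@iter_linearD f m) (iter_linear0 f m)). Qed.

Variables (f : {linear V -> V}) (I : finType) (w : I -> V) (d : I -> nat).
Hypothesis d_gt0 : forall s, (0 < d s)%N.
Hypothesis kill : forall s, iter (d s) f (w s) = 0.

Definition chain_vec (p : {s : I & 'I_(d s)}) : V :=
  iter (tagged p) f (w (tag p)).

Local Notation idx j := (Tagged (fun s => 'I_(d s)) j).

Lemma iter_chain0 (s : I) (m : nat) : (d s <= m)%N -> iter m f (w s) = 0.
Proof. by move=> /subnK <-; rewrite iterD kill iter_linear0. Qed.

(* Applying [f ^ m] to a relation kills the terms at distance less than [m]
   from the end of their chain and leaves the ends of the chains as the terms
   at distance [m]; so the coefficients vanish by descending induction on that
   distance. *)
Lemma free_chains :
  free (codom (fun s => iter (d s).-1 f (w s))) -> free (codom chain_vec).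
Proof.
move=> /free_codomP fu; apply/free_codomP => c c0.
have dist_lt (p : {s : I & 'I_(d s)}) :
    ((d (tag p)).-1 - tagged p < \max_s d s)%N.
  by have := leq_bigmax (F := d) (tag p); have := ltn_ord (tagged p); lia.
have vanish (h : nat) : forall p : {s : I & 'I_(d s)},
    (\max_s d s <= (d (tag p)).-1 - tagged p + h)%N -> c p = 0.
  elim: h => [|h IHh] p; first by have := dist_lt p; lia.
  move=> le_p.
  set m := ((d (tag p)).-1 - tagged p)%N in le_p.
  have [le_ph|gt_ph] := leqP (\max_s d s) (m + h); first exact: IHh.
  (* At most one [j] contributes to [a s], and none if the chain of [s] is too short. *)
  pose a s := \sum_(j < d s | ((d s).-1 - j)%N == m) c (idx j).
  have a0 : \sum_s a s *: iter (d s).-1 f (w s) = 0.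
    have := congr1 (iter m f) c0.
    rewrite iter_linear0 iter_linear_sum => fm0.
    rewrite -[RHS]fm0.
    rewrite (eq_bigr (fun s => \sum_(j < d s)
      iter m f (c (idx j) *: chain_vec (idx j)))); last first.
      move=> s _; rewrite scaler_suml big_mkcond; apply: eq_bigr => j _ /=.
      rewrite iter_linearZ /chain_vec /= -iterD; have ltj := ltn_ord j.
      case: eqP => [<-|ne_m]; first by rewrite subnK //; lia.
      have [lt_m|ge_m] := ltnP ((d s).-1 - j)%N m.
        by rewrite iter_chain0 ?scaler0 //; lia.
      by rewrite IHh ?scale0r //=; lia.
    by rewrite sig_big_dep /=; apply: eq_bigr => -[s j] _.
  have := fu _ a0 (tag p).
  rewrite /a (bigD1 (tagged p)) ?eqxx //= big1 ?addr0 => [|j].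
    by case: (p).
  move=> /andP[/eqP eq_m /eqP ne_j]; case: ne_j; apply: val_inj => /=.
  by have := ltn_ord j; have := ltn_ord (tagged p); lia.
by move=> p; apply: (vanish (\max_s d s)); lia.
Qed.

Local Open Scope classical_set_scope.

(** Freeness and the right cardinality give a basis; injectivity of [chain_vec], a consequence of
    freeness, makes the chains disjoint. *)
Lemma jordan_basis_chains :
    free (codom (fun s => iter (d s).-1 f (w s))) ->
    (\sum_s d s)%N = \dim {: V} ->
  jordan_basis f [set x | exists s j, (j < d s)%N /\ x = iter j f (w s)].
Proof.
move=> fu dimV; have fX := free_chains fu.
have inj_chain : injective chain_vec by apply/injectiveP/free_uniq.
split.
  exists (codom chain_vec); split.
    rewrite basisEfree fX subvf /= size_codom card_tagged.
    rewrite -dimV sumnE big_map big_enum /= leq_eqVlt.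
    by apply/orP; left; apply/eqP/eq_bigr => s _; rewrite card_ord.
  apply/seteqP; split=> x /=.
    case=> s [j [ltj ->]]; apply/codomP.
    by exists (idx (Ordinal ltj)).
  by case/codomP=> -[s j] ->; exists s, j; split; first exact: ltn_ord.
pose C s := [set iter j f (w s) | j in [set j | (j <= (d s).-1)%N]].
exists (range C); split.
- move=> _ [s _ <-]; exists (w s), (d s).-1; split=> //; last first.
    by rewrite prednK.
  (* A zero in the chain would make its last vector zero, against freeness. *)
  move=> j le_j; apply/eqP => fj0.
  have /free_codomP/(_ (fun t => (t == s)%:R)) := fu.
  have -> : \sum_x (x == s)%:R *: iter (d x).-1 f (w x) = 0 :> V.
    rewrite (bigD1 s) //= big1 => [|t /negPf->]; last by rewrite scale0r.
    by rewrite addr0 -(subnK le_j) iterD fj0 iter_linear0 scaler0.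
  by move=> /(_ erefl s)/eqP; rewrite eqxx oner_eq0.
- move=> _ _ [s _ <-] [t _ <-] [x [[i /= lei <-] [j /= lej]]].
  have lti : (i < d s)%N by have := d_gt0 s; lia.
  have ltj : (j < d t)%N by have := d_gt0 t; lia.
  move=> e; have /inj_chain/(congr1 tag)/= -> // :
    chain_vec (idx (Ordinal ltj)) =
    chain_vec (idx (Ordinal lti)) by [].
- apply/seteqP; split=> x /=.
    case=> s [j [ltj ->]]; exists (C s); first by exists s.
    by exists j => //=; lia.
  case=> _ [s _ <-] [j /= lej <-]; exists s, j; split=> //.
  by have := d_gt0 s; lia.
Qed.

End FreeFamilies.

Lemma Posz_pow2 (k : nat) : 2%:Z ^+ k = (2 ^ k)%N%:Z.
Proof. by elim: k => // k IHk; rewrite exprS IHk expnS PoszM. Qed.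

(** * Powers of [e] on tensors in characteristic 2 *)

Section TensorChains.
Variables (K : fieldType) (charK : 2%N \in [pchar K]) (n : nat).
Variables (A : 'M[K]_n) (v : int -> 'cV[K]_n).
Hypothesis hv : single_block_basis A v.

(** Below 1 both sides vanish. The upper bound matters: at [i = n + 1] the left side is 0 and the
    right side is [v n]. *)
Lemma shift_vec (i : int) : i <= n%:Z -> A *m v i = v (i - 1).
Proof.
case: hv => _ v0 Av le_in; have [i1|i0] := leP 1 i; first by rewrite Av ?i1.
by rewrite !v0 ?mulmx0 //; lia.
Qed.

Lemma vec_le0 (i : int) : i <= 0 -> v i = 0.
Proof. by case: hv => _ v0 _ i0; rewrite v0 ?i0. Qed.

Lemma vec_free (c : 'I_n -> K) :
  \sum_(i < n) c i *: v i.+1%:Z = 0 -> forall i, c i = 0.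
Proof.
case: hv => /basis_free fv _ _; move: c; apply/free_codomP.
rewrite (_ : codom _ = [seq v i%:Z | i <- iota 1 n]) //.
by rewrite codomE (iotaDl 1 0) -val_enum_ord -!map_comp; apply: eq_map.
Qed.

(** Column [j] of the relation is a linear relation among the basis vectors, with the [j]-th entries
    of the [u i] as coefficients. *)
Lemma tens_vec0 (u : 'I_n -> 'cV[K]_n) :
  \sum_(i < n) tens (v i.+1%:Z) (u i) = 0 -> forall i, u i = 0.
Proof.
move=> u0 i; apply/colP => j; rewrite mxE.
apply: (vec_free (c := fun i => u i j 0)); apply/colP => r.
move/matrixP/(_ r j): u0; rewrite !mxE !summxE => u0; rewrite -[RHS]u0.
by apply: eq_bigr => k _; rewrite !mxE big_ord1 !mxE mulrC.
Qed.

Lemma mx_addrr (M : 'M[K]_n) : M + M = 0.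
Proof. by rewrite -mulr2n -scaler_nat (pcharf0 charK) scale0r. Qed.

Notation f := (tens_act A).
Notation T x y := (tens (v x) (v y)).

(** Frobenius: doubling the exponent produces two equal mixed terms, which cancel in characteristic
    2. *)
Lemma iter_pow2_tens (k : nat) (x y : int) : x <= n%:Z -> y <= n%:Z ->
  iter (2 ^ k) f (T x y) = T (x - (2 ^ k)%N%:Z) y + T x (y - (2 ^ k)%N%:Z).
Proof.
elim: k x y => [|k IHk] x y lex ley.
  by rewrite -[LHS]/(f (T x y)) tens_actE !shift_vec.
rewrite expnS mul2n -addnn iterD IHk // iter_linearD !IHk //; try lia.
rewrite -[LHS]addrA [X in _ + X]addrA mx_addrr add0r.
by congr (T _ _ + T _ _); lia.
Qed.

Lemma iter_pred_pow2_tens (k : nat) (x y : int) : x <= n%:Z -> y <= n%:Z ->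
  iter (2 ^ k).-1 f (T x y) =
  \sum_(0 <= i < 2 ^ k) T (x - i%:Z) (y - (2 ^ k).-1%:Z + i%:Z).
Proof.
elim: k x y => [|k IHk] x y lex ley.
  by rewrite expn0 big_nat1 /=; congr (T _ _); lia.
have pos : (0 < 2 ^ k)%N by rewrite expn_gt0.
(* The two terms produced by the power $2^k$ yield the two halves of the range of [i]. *)
rewrite (_ : (2 ^ k.+1).-1 = (2 ^ k).-1 + 2 ^ k)%N; last by rewrite expnS; lia.
rewrite iterD iter_pow2_tens // iter_linearD !IHk //; try lia.
rewrite expnS mul2n -addnn [RHS](@big_cat_nat _ _ _ (2 ^ k)%N) ?leq_addr //=.
rewrite [LHS]addrC; congr (_ + _).
  by apply: eq_big_nat => i _; congr (T _ _); lia.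
rewrite -[X in _ = \sum_(X <= _ < _) _]add0n big_addn addnK.
by apply: eq_big_nat => i _; congr (T _ _); lia.
Qed.

(** In characteristic 2 signs can be inserted so that the sum telescopes; both ends contain the
    factor [v 0 = 0]. *)
Lemma tens_act_z_vec (s : nat) : (s <= n)%N -> f (z_vec v s) = 0.
Proof.
move=> les; rewrite linear_sum big_add1 succnK big_mkord.
rewrite (eq_bigr (fun i : 'I_s =>
  T i%:Z (s%:Z - i%:Z) + T i.+1%:Z (s%:Z - i.+1%:Z))); last first.
  move=> i _; have := ltn_ord i => lti; rewrite tens_actE !shift_vec; try lia.
  by congr (T _ _ + T _ _); lia.
rewrite -(big_mkord xpredT (fun i =>
  T i%:Z (s%:Z - i%:Z) + T i.+1%:Z (s%:Z - i.+1%:Z))).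
rewrite (eq_bigr (fun i => T i.+1%:Z (s%:Z - i.+1%:Z) -
                           T i%:Z (s%:Z - i%:Z))); last first.
  move=> i _; rewrite addrC; congr (_ + _).
  by apply/eqP; rewrite -addr_eq0 mx_addrr.
rewrite telescope_sumr // subrr (@vec_le0 0) //.
by rewrite /tens trmx0 mulmx0 mul0mx subrr.
Qed.

(** The first index descends from [u] to [l]. Where it exceeds [s] the second index is nonpositive,
    so all added terms vanish. *)
Lemma z_vec_widen (s : nat) (l u : int) : l <= 1 -> s%:Z <= u ->
  \sum_(0 <= i < absz (u - l + 1)) T (u - i%:Z) (s%:Z + 1 - (u - i%:Z)) =
  z_vec v s.
Proof.
move=> l1 su.
rewrite (@big_cat_nat _ _ _ (absz (u - s%:Z))) //=; last lia.
rewrite big_nat big1 ?add0r => [|i /andP[_ lti]]; last first.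
  by rewrite (@vec_le0 (_ + 1 - _)) ?/tens ?trmx0 ?mulmx0 //; lia.
rewrite (@big_cat_nat _ _ _ (absz (u - s%:Z) + s)%N) //=; try lia.
rewrite addrC big_nat big1 ?add0r => [|i /andP[lti _]]; last first.
  by rewrite (@vec_le0 (u - _)) ?/tens ?mul0mx //; lia.
rewrite /z_vec big_add1 /= [RHS]big_nat_rev /=.
rewrite -[X in \sum_(X <= _ < _) _]add0n big_addn addKn.
by apply: eq_big_nat => i lti; congr (T _ _); lia.
Qed.

Lemma sum_blocks (V : zmodType) (q c : nat) (g : nat -> V) :
  \sum_(0 <= t < c) \sum_(0 <= i < q) g (t * q + i)%N =
  \sum_(0 <= i < c * q) g i.
Proof.
elim: c => [|c IHc]; first by rewrite !big_geq.
rewrite big_nat_recr //= IHc mulSn addnC.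
rewrite [RHS](@big_cat_nat _ _ _ (c * q)%N) ?leq_addr //=; congr (_ + _).
rewrite -[X in _ = \sum_(X <= _ < _) _]add0n big_addn addKn.
by apply: eq_bigr => i _; rewrite addnC.
Qed.

(** The indices of each term add up to $s + 2^{bt}$, so its image lies on the antidiagonal of sum $s
    + 1$. The upper bounds in [admissible_j0] allow the shifts; the lower bounds make the joined
    runs of first indices cover $1, \ldots, s$. *)
Lemma iter_w_vec (bt s j0 : nat) : (0 < bt)%N -> admissible_j0 n bt s j0 ->
  iter (2 ^ bt).-1 f
    (\sum_(0 <= t < (2 * j0).+1)
       let j := t%:Z - j0%:Z in
       T (s./2%:Z + 2%:Z ^+ bt.-1 + j * 2%:Z ^+ bt)
         ((uphalf s)%:Z + 2%:Z ^+ bt.-1 - j * 2%:Z ^+ bt)) = z_vec v s.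
Proof.
case: bt => // k _ [] /=.
have halves : (s./2 + uphalf s = s)%N.
  by rewrite uphalf_half; have := odd_double_half s; lia.
rewrite !Posz_pow2.
set p := (2 ^ k)%N; have -> : (2 ^ k.+1 = 2 * p)%N by rewrite expnS.
move=> /andP[h1 h2] /andP[h3 h4].
have p_gt0 : (0 < p)%N by rewrite expn_gt0.
(* Reversal makes the first indices descend, as they do within each run. *)
rewrite iter_linear_sum big_nat_rev /= add0n big_nat.
(* The largest first index, attained at $j = j_0$. *)
pose u : int := s./2%:Z + p%:Z + j0%:Z * (2 * p)%N%:Z.
rewrite (eq_bigr (fun t : nat => \sum_(0 <= i < 2 * p)
  T (u - (t * (2 * p) + i)%N%:Z)
    (s%:Z + 1 - (u - (t * (2 * p) + i)%N%:Z)))); last first.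
  move=> t /andP[_ lt_t].
  have -> : ((2 * j0).+1 - t.+1)%N%:Z = (2 * j0)%N%:Z - t%:Z by lia.
  rewrite -[(2 * p)%N]/(2 * 2 ^ k)%N -expnS iter_pred_pow2_tens; first last.
  - by rewrite expnS -/p; nia.
  - by rewrite expnS -/p; nia.
  apply: eq_big_nat => i lti; rewrite expnS -/p /u; congr (T _ _); nia.
rewrite -big_nat (sum_blocks _ _ (fun i =>
  T (u - i%:Z) (s%:Z + 1 - (u - i%:Z)))).
rewrite -(@z_vec_widen s (u + 1 - ((2 * j0).+1 * (2 * p))%N%:Z) u); try nia.
by congr (\sum_(0 <= i < _) _); nia.
Qed.

(** Collecting a relation by left factors, the right factor of [v 1] is a combination of the basis
    vectors with the same coefficients, and it must vanish. *)
Lemma free_z_vec : free (codom (fun s : 'I_n => z_vec v s.+1)).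
Proof.
apply/free_codomP => c c0 s.
have n_gt0 : (0 < n)%N := leq_ltn_trans (leq0n s) (ltn_ord s).
apply: vec_free s.
pose u (i : 'I_n) := \sum_(s < n) c s *: v (s.+1%:Z - i%:Z).
have: \sum_(i < n) tens (v i.+1%:Z) (u i) = 0.
  rewrite -[RHS]c0.
  under eq_bigr do rewrite /tens linear_sum /= mulmx_sumr.
  rewrite exchange_big /=; apply: eq_bigr => s _.
  rewrite /z_vec big_add1 succnK.
  rewrite -(big_mkord xpredT (fun i =>
    v i.+1%:Z *m (c s *: v (s.+1%:Z - i%:Z))^T)).
  (* Beyond [s] the second index is nonpositive, so the sum may run over all [i < n]. *)
  rewrite (@big_cat_nat _ _ _ s.+1) //= [X in _ + X]big_nat.
  rewrite [X in _ + X]big1 ?addr0 => [|i /andP[lti _]]; last first.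
    by rewrite (@vec_le0 (_ - _)) ?scaler0 ?trmx0 ?mulmx0 //; lia.
  rewrite scaler_sumr; apply: eq_bigr => i _.
  by rewrite linearZ /= -scalemxAr /tens; congr (_ *: (_ *m (v _)^T)); lia.
move/tens_vec0/(_ (Ordinal n_gt0)); rewrite /u => u0; rewrite -[RHS]u0.
by apply: eq_bigr => i _; rewrite subr0.
Qed.

End TensorChains.

(** * Blocks cut out by the numbers $n_k$ *)

Section BlockCounting.
Variables (n : nat) (b : seq nat).
Hypothesis hb : alternating_expansion n b.
Notation T k := (tail_sum b k).

Lemma tail_sum_first : T 1 = n%:Z.
Proof. by case: hb => _ ->; apply: eq_bigr => i _; rewrite addn1. Qed.

Lemma tail_sum_last : T (size b).+1 = 0.
Proof. by rewrite /tail_sum big_geq. Qed.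

Lemma tail_sumS (k : nat) : (0 < k <= size b)%N ->
  T k + T k.+1 = (2 ^ beta b k)%N%:Z.
Proof.
move=> /andP[k0 kb]; rewrite /tail_sum big_ltn //.
rewrite addnn -signr_odd odd_double mul1r.
rewrite Posz_pow2 -addrA -big_split big1 ?addr0 //= => i _.
by rewrite addnS exprS !mulNr mul1r addrN.
Qed.

Lemma beta_decr (k : nat) : (0 < k < size b)%N -> (beta b k.+1 < beta b k)%N.
Proof.
case: hb => sb _; case: k => // k /= ltk.
by have /sortedP/(_ k) := sb; rewrite /beta /=; apply.
Qed.

(** Descending from $k = r$: for $k < r$, $n_{k+1} \leq 2^{\beta_{k+1}} \leq 2^{\beta_k - 1}$, hence
    $n_k = 2^{\beta_k} - n_{k+1} \geq n_{k+1}$. *)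
Lemma tail_sum_bounds (k : nat) : (0 < k <= size b)%N ->
  0 <= T k.+1 /\ T k.+1 <= T k.
Proof.
move=> /andP[k0 kb]; move: {2}(size b - k)%N (erefl (size b - k)%N) => m.
elim: m k k0 kb => [|m IHm] k k0 kb dk; have := @tail_sumS k; rewrite k0 kb.
  have -> : k.+1 = (size b).+1 by lia.
  by rewrite tail_sum_last; lia.
have := @tail_sumS k.+1; have := IHm k.+1 isT.
have : (2 ^ (beta b k.+1).+1 <= 2 ^ beta b k)%N.
  by rewrite leq_exp2l // beta_decr //; lia.
rewrite expnS => le_beta IHk; have [||? ?] := IHk; lia.
Qed.

Lemma tail_sum_anti (j k : nat) : (0 < j)%N -> (j <= k <= (size b).+1)%N ->
  T k <= T j.
Proof.
move=> j0 /andP[/subnK <-]; elim: (k - j)%N => // m IHm le_b.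
apply: le_trans (IHm _); rewrite ?addSn;
  by have [] := @tail_sum_bounds (m + j); lia.
Qed.

(** Monotonicity of the tails makes the blocks disjoint. *)
Lemma in_block_index (k s : nat) : (0 < k <= size b)%N -> in_block n b k s ->
  block_index n b s = k.
Proof.
move=> /andP[k0 kb] bks; rewrite /block_index.
set p := fun i => _; set i := find _ _.
have k1 : (k.-1 < size (iota 0 (size b)))%N by rewrite size_iota; lia.
have hasp : has p (iota 0 (size b)).
  by apply/hasP; exists k.-1; rewrite ?mem_iota /p ?prednK //; lia.
have lti : (i < size b)%N by have := hasp; rewrite has_find size_iota.
have := nth_find 0%N hasp; rewrite -/i nth_iota // add0n /p /in_block => bis.
move: bks; rewrite /in_block => bks.
have [lt_ik|lt_ki|//] := ltngtP i.+1 k.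
  by have := @tail_sum_anti i.+2 k; lia.
by have := @tail_sum_anti k.+1 i.+1; lia.
Qed.

Lemma in_block_exists (s : nat) : (1 <= s <= n)%N ->
  exists2 k, (0 < k <= size b)%N & in_block n b k s.
Proof.
move=> s1n.
(* Descending from $n_1 = n > n - s$, some block must be met, as $n_{r+1} = 0 \leq n - s$. *)
have: forall k, (k <= size b)%N -> n%:Z - s%:Z < T k.+1 \/
    exists2 k, (0 < k <= size b)%N & in_block n b k s.
  elim=> [|k IHk] lek; first by left; rewrite tail_sum_first; lia.
  case: (IHk _) => [|ltT|]; [lia| | by right].
  have [leT|] := leP (T k.+2) (n%:Z - s%:Z); last by left.
  by right; exists k.+1; rewrite ?lek // /in_block leT ltT.
by move=> /(_ (size b) (leqnn _)) [|//]; rewrite tail_sum_last; lia.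
Qed.

Lemma sum_block_lengths :
  (\sum_(s < n) 2 ^ beta b (block_index n b s.+1) = n * n)%N.
Proof.
(* With $t = n - s$, the range $t < n_k$ consists of the last [m] blocks. Induction on [m] adds
   $(n_k - n_{k+1}) 2^{\beta_k} = n_k^2 - n_{k+1}^2$. *)
suff sumT m k : (0 < k)%N -> (k + m = (size b).+1)%N ->
    (\sum_(0 <= t < absz (T k)) 2 ^ beta b (block_index n b (n - t)) =
     absz (T k) * absz (T k))%N.
  rewrite -(big_mkord xpredT (fun s =>
    2 ^ beta b (block_index n b s.+1)))%N.
  have := sumT (size b) 1%N isT (add1n _); rewrite tail_sum_first => <-.
  rewrite big_nat_rev /= add0n.
  by apply: eq_big_nat => i lti; rewrite subnSK //; lia.
elim: m k => [|m IHm] k k0 km.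
  by rewrite -(addn0 k) km tail_sum_last big_geq.
have kb : (0 < k <= size b)%N by lia.
have [T0 T1] := tail_sum_bounds kb; have Tn := @tail_sum_anti 1 k.
rewrite tail_sum_first in Tn.
rewrite (@big_cat_nat _ _ _ (absz (T k.+1))) //=; last lia.
rewrite IHm //; last lia.
rewrite (eq_big_nat _ _ (F2 := fun=> (2 ^ beta b k)%N)) => [|t lt_t].
  by rewrite sum_nat_const_nat; have := tail_sumS kb; nia.
by rewrite (@in_block_index k) // /in_block; lia.
Qed.

End BlockCounting.

(** * The Jordan basis of the tensor square *)

Theorem theorem3p6 (K : fieldType) (charK : 2%N \in [pchar K])
  (n : nat) (n_gt0 : (0 < n)%N)
  (b : seq nat) (hb : consecutive_ones_expansion n b)
  (q m : nat) (hq : q = (2 ^ m)%N) (hnq : (n <= q)%N)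
  (rho : {linear 'rV[K]_m -> 'M[K]_n}) (hrho : restricted_module rho)
  (e : 'rV[K]_m) (he : restricted_generator e)
  (v : int -> 'cV[K]_n) (hv : single_block_basis (rho e) v)
  (j0 : nat -> nat)
  (hj0 : forall s : nat, (1 <= s <= n)%N ->
    (0 < beta b (block_index n b s))%N ->
    admissible_j0 n (beta b (block_index n b s)) s (j0 s)) :
  jordan_basis (tens_act (rho e)) (B_union (rho e) v b j0).
Proof.
have [ab _] := hb.
pose w (s : 'I_n) := w_vec v b j0 s.+1.
pose d (s : 'I_n) := (2 ^ beta b (block_index n b s.+1))%N.
have d_gt0 s : (0 < d s)%N by rewrite expn_gt0.
(* For exponent 0 the chain is [z_vec] alone and nothing is iterated. *)
have wz (s : 'I_n) : iter (d s).-1 (tens_act (rho e)) (w s) = z_vec v s.+1.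
  have lts := ltn_ord s; rewrite /d /w /w_vec; case: eqP => [->//|bt0].
  by apply: (iter_w_vec charK hv); [lia | apply: hj0; lia].
have kill s : iter (d s) (tens_act (rho e)) (w s) = 0.
  by rewrite -(prednK (d_gt0 s)) iterS wz (tens_act_z_vec charK hv).
(* As [s] determines [k], the union can be indexed by [s] alone. *)
have -> : B_union (rho e) v b j0 =
    [set x | exists s j, (j < d s)%N /\
               x = iter j (tens_act (rho e)) (w s)]%classic.
  apply/seteqP; split=> x /=.
    case=> k /= kb [s [j [s1n bks lej ->]]].
    have lts : (s.-1 < n)%N by lia.
    have s1 : s.-1.+1 = s by lia.
    exists (Ordinal lts), j; rewrite /d /w /= s1; split=> //.
    rewrite (in_block_index ab kb bks).
    by have : (0 < 2 ^ beta b k)%N by [rewrite expn_gt0]; lia.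
  case=> s [j [ltj ->]].
  have s1n : (1 <= s.+1 <= n)%N by rewrite ltn_ord.
  have [k kb bks] := in_block_exists ab s1n.
  exists k => //; exists s.+1, j; split=> //.
  by move: ltj; rewrite /d (in_block_index ab kb bks); lia.
apply: jordan_basis_chains => //; last first.
  by rewrite (sum_block_lengths ab) dimvf dim_matrix.
by rewrite (eq_codom wz); apply: free_z_vec hv.
Qed.
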